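(* In $\mathbb{R}^3$, there are only three types of five-body central configurations of which a four-body sub configuration is central; that is, a five-body configuration is central and has a central four-body sub configuration if and only if it is of one of the following types: (1) a square with four equal masses at its vertices and an arbitrary mass $m_0$ at its center; (2) any four-body co-circular central configuration together with an arbitrary mass $m_0$ placed on the line through the center of the circle orthogonal to the plane of the circle, at height $h=\sqrt{r_0^2-r^2}$ from that plane; (3) a regular tetrahedron with four equal masses at its vertices and an arbitrary mass $m_0$ at its center.
   Context: All masses are positive, and the bodies of a configuration occupy pairwise distinct positions in $\mathbb{R}^3$. For bodies with masses $m_1,\dots,m_k$ at $\mathbf{q}_1,\dots,\mathbf{q}_k$ ($k\ge2$) put $m=\sum_i m_i$, $c=\frac1m\sum_i m_i\mathbf{q}_i$, $U=\sum_{i<j}\frac{m_im_j}{|\mathbf{q}_i-\mathbf{q}_j|}$, $I=\sum_i m_i|\mathbf{q}_i-c|^2$. The configuration is central if $\nabla U+\frac{\lambda}{2}\nabla I=0$ with $\lambda=U/I$, i.e. $\sum_{j\ne i} m_im_j\frac{\mathbf{q}_j-\mathbf{q}_i}{|\mathbf{q}_j-\mathbf{q}_i|^3}=-\lambda m_i(\mathbf{q}_i-c)$ for all $i$. A four-body sub configuration is obtained by removing one body, the others keeping their masses and positions. A configuration is co-circular if its bodies lie on a common circle. For a four-body co-circular central configuration, $r$ is the radius of the circle and $r_0=(m/\lambda)^{1/3}=(mI/U)^{1/3}$, computed from those four bodies only; one has $r<r_0$ for all four-body co-circular central configurations, so $h$ is well defined and positive. *)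

(* Defs.v *)
From HB Require Import structures.
From mathcomp Require Import all_boot all_order all_algebra.
From mathcomp Require Import reals exp.
Set Implicit Arguments.
Unset Strict Implicit.
Unset Printing Implicit Defensive.
Import Order.TTheory GRing.Theory Num.Theory.
Local Open Scope ring_scope.

Section Euclidean.
Context {R : realType}.
Implicit Types u v : 'rV[R]_3.

Definition dot u v : R := \sum_(i < 3) u 0 i * v 0 i.

(* The norm `|u| that analysis puts on row vectors is the sup norm, hence a
   separate Euclidean norm. *)
Definition enorm u : R := Num.sqrt (dot u u).

Definition centroid n (q : 'I_n -> 'rV[R]_3) : 'rV[R]_3 :=
  n%:R^-1 *: \sum_(i < n) q i.

(* a, b, c, d are the vertices in cyclic order. *)
Definition square a b c d : Prop :=
  [/\ a != b, b - a = c - d, dot (b - a) (d - a) = 0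
    & enorm (b - a) = enorm (d - a)].

(* The cyclic order of the vertices need not be that of the labels. *)
Definition is_square (q : 'I_4 -> 'rV[R]_3) : Prop :=
  exists i j k l : 'I_4,
    uniq [:: i; j; k; l] /\ square (q i) (q j) (q k) (q l).

Definition is_regular_tetrahedron (q : 'I_4 -> 'rV[R]_3) : Prop :=
  exists s : R, 0 < s /\ forall i j : 'I_4, i != j -> enorm (q i - q j) = s.

(* The circle of center o and radius r in the plane through o with unit
   normal nu. *)
Definition is_circle (o nu : 'rV[R]_3) (r : R) : Prop :=
  enorm nu = 1 /\ 0 < r.

Definition on_circle (o nu : 'rV[R]_3) (r : R) (x : 'rV[R]_3) : Prop :=
  dot (x - o) nu = 0 /\ enorm (x - o) = r.

End Euclidean.

Section Configurations.
Context {R : realType} {n : nat}.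
Variables (m : 'I_n -> R) (q : 'I_n -> 'rV[R]_3).

Definition total_mass : R := \sum_(i < n) m i.

Definition center_of_mass : 'rV[R]_3 :=
  total_mass^-1 *: \sum_(i < n) m i *: q i.

Definition potential : R :=
  \sum_(i < n) \sum_(j < n | (i < j)%N) m i * m j / enorm (q i - q j).

Definition inertia : R :=
  \sum_(i < n) m i * enorm (q i - center_of_mass) ^+ 2.

Definition lambda : R := potential / inertia.

Definition central : Prop :=
  forall i : 'I_n,
    \sum_(j < n | j != i)
      (m i * m j / enorm (q j - q i) ^+ 3) *: (q j - q i)
    = - (lambda * m i) *: (q i - center_of_mass).

Definition r0 : R := (total_mass / lambda) `^ (3%:R^-1).

End Configurations.

Definition remove (T : Type) n (k : 'I_n) (f : 'I_n -> T) : 'I_n.-1 -> T :=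
  fun i => f (lift k i).

Section Types.
Context {R : realType}.
Variables (m : 'I_5 -> R) (q : 'I_5 -> 'rV[R]_3).

Definition centered_square : Prop :=
  exists k : 'I_5,
    [/\ forall i j : 'I_4, remove k m i = remove k m j,
        is_square (remove k q)
      & q k = centroid (remove k q)].

Definition cocircular_with_axial_mass : Prop :=
  exists k : 'I_5, exists o nu : 'rV[R]_3, exists r : R,
    [/\ is_circle o nu r,
        forall i : 'I_4, on_circle o nu r (remove k q i),
        central (remove k m) (remove k q)
      & exists t : R,
          q k = o + t *: nu /\
          `|t| = Num.sqrt (r0 (remove k m) (remove k q) ^+ 2 - r ^+ 2)].

Definition centered_tetrahedron : Prop :=
  exists k : 'I_5,
    [/\ forall i j : 'I_4, remove k m i = remove k m j,
        is_regular_tetrahedron (remove k q)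
      & q k = centroid (remove k q)].

End Types.

(* Main.v *)
(** With [K = lambda / total_mass], a configuration is central when at every
    body [i] the sum of [m_j (r_ij^-3 - K) (q_j - q_i)] vanishes.  Subtracting
    the four-body equations from the five-body ones gives, with [c] the center
    of mass of the four bodies and [q_0] the added body at distance [rho_i],
    [(K - K') M (c - q_i) + m_0 (rho_i^-3 - K') (q_0 - q_i) = 0].  So either
    [K = K'] and every [rho_i] is [r0], or [q_0 = c] and the [rho_i] coincide,
    or all bodies lie on one line; the last case is impossible because the
    force balance on a line has at most two solutions.

    Hence the four bodies lie on a sphere around [q_0].  On a sphere an affine
    relation [sum a_j = 0], [sum a_j q_j = 0] satisfies [sum_j a_j r_ij^2 = 0]
    for every [i], so it is trivial as soon as one coefficient vanishes.  The
    rows of the matrix [m_i m_j (r_ij^-3 - K)], completed on the diagonal, are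
    such relations: the matrix is zero (regular tetrahedron) or has rank one
    (Dziobek), and then the sides are shorter than [r0], the diagonals longer,
    and [S_ij S_kl = S_jk S_li] for [S = r^-3 - K].  If moreover [c = q_0], the
    sums [sum_j m_j r_ij^2] and [sum_j m_j / r_ij] do not depend on [i];
    comparing them at opposite bodies forces all sides to be equal. *)

Require Import Defs.
From HB Require Import structures.
From mathcomp Require Import all_boot all_order all_algebra.
From mathcomp Require Import reals exp.
From mathcomp Require Import ring lra.
Set Implicit Arguments.
Unset Strict Implicit.
Unset Printing Implicit Defensive.
Import Order.TTheory GRing.Theory Num.Theory.
Local Open Scope ring_scope.

(** * Euclidean geometry of vectors in dimension three *)

Section EuclideanFacts.
Context {R : realType}.
Implicit Types (u v w : 'rV[R]_3) (a : R).

Lemma dotE u v : dot u v = u 0 0 * v 0 0 + u 0 1 * v 0 1 + u 0 2%:R * v 0 2%:R.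
Proof.
rewrite /dot !big_ord_recl big_ord0 addr0 addrA.
by congr (_ + u 0 _ * v 0 _ + u 0 _ * v 0 _); apply/val_inj.
Qed.

Lemma dotC u v : dot u v = dot v u.
Proof. by rewrite !dotE; ring. Qed.

Lemma dotDl u v w : dot (u + v) w = dot u w + dot v w.
Proof. by rewrite !dotE !mxE; ring. Qed.

Lemma dotZl a u v : dot (a *: u) v = a * dot u v.
Proof. by rewrite !dotE !mxE; ring. Qed.

Lemma dotNl u v : dot (- u) v = - dot u v.
Proof. by rewrite !dotE !mxE; ring. Qed.

Lemma dotBl u v w : dot (u - v) w = dot u w - dot v w.
Proof. by rewrite dotDl dotNl. Qed.

Lemma dot0l u : dot 0 u = 0.
Proof. by rewrite !dotE !mxE; ring. Qed.

Lemma dotDr u v w : dot w (u + v) = dot w u + dot w v.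
Proof. by rewrite !(dotC w) dotDl. Qed.

Lemma dotZr a u v : dot v (a *: u) = a * dot v u.
Proof. by rewrite !(dotC v) dotZl. Qed.

Lemma dotNr u v : dot v (- u) = - dot v u.
Proof. by rewrite !(dotC v) dotNl. Qed.

Lemma dotBr u v w : dot w (u - v) = dot w u - dot w v.
Proof. by rewrite dotDr dotNr. Qed.

Definition dotlin := (dotDl, dotDr, dotNl, dotNr, dotZl, dotZr).

Lemma dot_suml (I : finType) (F : I -> 'rV[R]_3) v :
  dot (\sum_i F i) v = \sum_i dot (F i) v.
Proof. by elim/big_rec2: _ => [|i y1 y2 _ <-]; rewrite ?dot0l ?dotDl. Qed.

Lemma dot_ge0 u : 0 <= dot u u.
Proof. by apply: sumr_ge0 => i _; rewrite -expr2 sqr_ge0. Qed.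

Lemma dot_eq0 u : (dot u u == 0) = (u == 0).
Proof.
apply/idP/eqP => [|->]; last by rewrite dot0l.
rewrite psumr_eq0 => [/allP u0|i _]; last by rewrite -expr2 sqr_ge0.
apply/rowP => i; apply/eqP; rewrite mxE.
by have := u0 i (mem_index_enum i); rewrite /= mulf_eq0 orbb.
Qed.

Lemma enorm_sqr u : enorm u ^+ 2 = dot u u.
Proof. by rewrite sqr_sqrtr // dot_ge0. Qed.

Lemma enorm_ge0 u : 0 <= enorm u.
Proof. exact: sqrtr_ge0. Qed.

Lemma enorm_eq0 u : (enorm u == 0) = (u == 0).
Proof. by rewrite -dot_eq0 -enorm_sqr sqrf_eq0. Qed.

Lemma enorm_gt0 u : (0 < enorm u) = (u != 0).
Proof. by rewrite lt_neqAle enorm_ge0 andbT eq_sym enorm_eq0. Qed.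

Lemma enormN u : enorm (- u) = enorm u.
Proof. by rewrite /enorm !dotlin opprK. Qed.

Lemma enormB u v : enorm (u - v) = enorm (v - u).
Proof. by rewrite -enormN opprB. Qed.

Lemma enormZ a u : enorm (a *: u) = `|a| * enorm u.
Proof. by rewrite /enorm !dotlin mulrA -expr2 sqrtrM ?sqr_ge0 // sqrtr_sqr. Qed.

Lemma enorm_eq u a : 0 <= a -> (enorm u == a) = (dot u u == a ^+ 2).
Proof. by move=> a0; rewrite -enorm_sqr eqrXn2 // enorm_ge0. Qed.

Lemma exists_normal u v : exists2 nu, enorm nu = 1 & dot u nu = 0 /\ dot v nu = 0.
Proof.
have [n n0 [un vn]] : exists2 n : 'rV[R]_3, n != 0 & dot u n = 0 /\ dot v n = 0.
  pose B := col_mx u v.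
  have : kermx B^T != 0.
    rewrite -mxrank_eq0 mxrank_ker subn_eq0 -ltnNge.
    by rewrite (leq_ltn_trans (rank_leq_col _)).
  case/rowV0Pn => n /sub_kermxP nB n0; exists n => //.
  have E i : (n *m B^T) 0 i = dot (row i B) n.
    by rewrite !mxE; apply: eq_bigr => j _; rewrite !mxE mulrC.
  have := E (lshift 1 0); have := E (rshift 1 0).
  by rewrite nB !mxE rowKd rowKu !row_id.
exists ((enorm n)^-1 *: n).
  by rewrite enormZ normfV (ger0_norm (enorm_ge0 n)) mulVf ?enorm_eq0.
by rewrite !dotZr un vn mulr0.
Qed.

Lemma exists_relation (v : 'I_4 -> 'rV[R]_3) :
  exists2 a : 'I_4 -> R, exists i, a i != 0 & \sum_i a i *: v i = 0.
Proof.
pose A := \matrix_i v i.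
have : kermx A != 0.
  by rewrite -mxrank_eq0 mxrank_ker subn_eq0 -ltnNge (leq_ltn_trans (rank_leq_col _)).
case/rowV0Pn => a /sub_kermxP aA a0; exists (fun i => a 0 i).
  by case/rV0Pn: a0 => i ai; exists i.
rewrite -[RHS]aA mulmx_sum_row; apply: eq_bigr => i _.
by rewrite rowK.
Qed.

(** The difference of the two sides is the Gram determinant of [u], [v], [w], the square of their
    determinant [d]. A common normal forces [d = 0], because [d * dot nu nu] is a combination of the
    three products with [nu] (Cramer's rule). *)
Lemma planar_gram u v w nu : nu != 0 ->
  dot u nu = 0 -> dot v nu = 0 -> dot w nu = 0 ->
  dot u u * dot v v * dot w w + 2 * dot u v * dot v w * dot u w
  = dot u u * dot v w ^+ 2 + dot v v * dot u w ^+ 2 + dot w w * dot u v ^+ 2.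
Proof.
move=> nu0 un vn wn.
pose d := u 0 0 * (v 0 1 * w 0 2%:R - v 0 2%:R * w 0 1)
  + u 0 1 * (v 0 2%:R * w 0 0 - v 0 0 * w 0 2%:R)
  + u 0 2%:R * (v 0 0 * w 0 1 - v 0 1 * w 0 0).
suff d0 : d = 0.
  apply/eqP; rewrite -subr_eq0; apply/eqP.
  by transitivity (d * d); [rewrite /d !dotE; ring | rewrite d0 mul0r].
apply: contraNeq nu0 => d0; rewrite -dot_eq0.
have : d * dot nu nu =
  dot u nu * (nu 0 0 * (v 0 1 * w 0 2%:R - v 0 2%:R * w 0 1) +
    nu 0 1 * (v 0 2%:R * w 0 0 - v 0 0 * w 0 2%:R) +
    nu 0 2%:R * (v 0 0 * w 0 1 - v 0 1 * w 0 0))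
  + dot v nu * (nu 0 0 * (w 0 1 * u 0 2%:R - w 0 2%:R * u 0 1) +
    nu 0 1 * (w 0 2%:R * u 0 0 - w 0 0 * u 0 2%:R) +
    nu 0 2%:R * (w 0 0 * u 0 1 - w 0 1 * u 0 0))
  + dot w nu * (nu 0 0 * (u 0 1 * v 0 2%:R - u 0 2%:R * v 0 1) +
    nu 0 1 * (u 0 2%:R * v 0 0 - u 0 0 * v 0 2%:R) +
    nu 0 2%:R * (u 0 0 * v 0 1 - u 0 1 * v 0 0)).
  by rewrite /d !dotE; ring.
by rewrite un vn wn !mul0r !addr0 => /eqP; rewrite mulf_eq0 (negPf d0).
Qed.

End EuclideanFacts.

(** * The equilibrium equations with a free multiplier *)

Section Balanced.
Context {R : realType} {n : nat}.
Implicit Types (m : 'I_n -> R) (q : 'I_n -> 'rV[R]_3) (K : R).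

Definition dist q i j : R := enorm (q j - q i).

Lemma distC q i j : dist q i j = dist q j i.
Proof. exact: enormB. Qed.

Lemma dist0 q i : dist q i i = 0.
Proof. by apply/eqP; rewrite enorm_eq0 subrr. Qed.

Lemma dist_gt0 q : injective q -> forall i j, i != j -> 0 < dist q i j.
Proof. by move=> q_inj i j ij; rewrite enorm_gt0 subr_eq0 (inj_eq q_inj) eq_sym. Qed.

(** For [K = (s ^+ 3)^-1] and distinct bodies, the sign tells whether they are closer than [s]. On
    the diagonal the inverse of 0 is 0 and the value is [- K]; such terms always come with a zero
    factor. *)
Definition excess K q i j : R := (dist q i j ^+ 3)^-1 - K.

(* Since the center of mass is the weighted mean of the positions, the force
   towards it can be distributed over the pairs; [K] is [lambda / total_mass],
   that is, the inverse cube of [r0]. *)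
Definition balanced K m q : Prop :=
  forall i, \sum_j (m j * excess K q i j) *: (q j - q i) = 0.

Lemma sum_from_point m q p : total_mass m != 0 ->
  \sum_j m j *: (q j - p) = total_mass m *: (center_of_mass m q - p).
Proof.
move=> M0; rewrite scalerBr /center_of_mass scalerA divff // scale1r.
rewrite /total_mass scaler_suml -sumrB.
by apply: eq_bigr => j _; rewrite scalerBr.
Qed.

Lemma balancedE K m q : total_mass m != 0 -> balanced K m q <->
  forall i, \sum_j (m j / enorm (q j - q i) ^+ 3) *: (q j - q i)
    = (K * total_mass m) *: (center_of_mass m q - q i).
Proof.
move=> M0.
have E i : \sum_j (m j * excess K q i j) *: (q j - q i)
  = \sum_j (m j / enorm (q j - q i) ^+ 3) *: (q j - q i)
    - (K * total_mass m) *: (center_of_mass m q - q i).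
  rewrite -scalerA -sum_from_point // scaler_sumr -sumrB.
  by apply: eq_bigr => j _; rewrite scalerA -scalerBl mulrBr (mulrC K).
by split=> H i; move/eqP: (H i); rewrite E ?subr_eq0 => /eqP // ->; rewrite subrr.
Qed.

Lemma central_balanced m q : (forall i, 0 < m i) -> total_mass m != 0 ->
  central m q <-> balanced (lambda m q / total_mass m) m q.
Proof.
move=> m0 M0.
have E i : \sum_(j < n | j != i) (m i * m j / enorm (q j - q i) ^+ 3) *: (q j - q i)
  = m i *: \sum_j (m j / enorm (q j - q i) ^+ 3) *: (q j - q i).
  rewrite scaler_sumr [RHS](bigD1 i) //= subrr scaler0 scaler0 add0r.
  by apply: eq_bigr => j _; rewrite scalerA mulrA.
split=> [C|/(balancedE _ _ M0) B i].
  apply/balancedE => // i; apply: (scalerI (lt0r_neq0 (m0 i))).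
  by rewrite -E C divfK // scaleNr -scalerN opprB scalerA mulrC.
by rewrite E B divfK // scaleNr -scalerN opprB scalerA mulrC.
Qed.

Lemma sum_pairs (f : 'I_n -> 'I_n -> R) :
  (forall i j, f i j = f j i) -> (forall i, f i i = 0) ->
  \sum_i \sum_j f i j = 2 * \sum_(i < n) \sum_(j < n | (i < j)%N) f i j.
Proof.
move=> fC f0.
transitivity (\sum_(i < n) (\sum_(j < n | (i < j)%N) f i j + \sum_(j < n | (j < i)%N) f i j)).
  apply: eq_bigr => i _; rewrite (bigID (fun j : 'I_n => (i < j)%N)) /=; congr (_ + _).
  rewrite big_mkcond [RHS]big_mkcond; apply: eq_bigr => j _.
  by case: ltngtP => //= /val_inj ->; rewrite f0.
rewrite big_split /= [X in _ + X](exchange_big_dep predT) //=.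
rewrite mulrDl !mul1r; congr (_ + _).
by apply: eq_bigr => i _; apply: eq_bigr => j _.
Qed.

End Balanced.

(** * The multiplier is determined by the configuration *)

Section Lambda.
Context {R : realType} {n : nat}.
Variables (m : 'I_n.+2 -> R) (q : 'I_n.+2 -> 'rV[R]_3).
Hypotheses (m_gt0 : forall i, 0 < m i) (q_inj : injective q).

Lemma total_mass_gt0 : 0 < total_mass m.
Proof.
rewrite /total_mass (bigD1 ord0) //= ltr_pwDl // sumr_ge0 // => i _.
exact: ltW.
Qed.

Let M0 : total_mass m != 0 := lt0r_neq0 total_mass_gt0.

Lemma potential_gt0 : 0 < potential m q.
Proof.
have p0 i j : 0 <= m i * m j / enorm (q i - q j).
  by rewrite divr_ge0 ?enorm_ge0 // mulr_ge0 // ltW.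
rewrite /potential (bigD1 ord0) //= ltr_pwDl //; last first.
  by apply: sumr_ge0 => i _; apply: sumr_ge0 => j _.
rewrite (bigD1 ord_max) //= ltr_pwDl ?sumr_ge0 //.
by rewrite divr_gt0 ?mulr_gt0 // enorm_gt0 subr_eq0 (inj_eq q_inj).
Qed.

Lemma inertia_gt0 : 0 < inertia m q.
Proof.
have p0 i : 0 <= m i * enorm (q i - center_of_mass m q) ^+ 2.
  by rewrite mulr_ge0 ?exprn_ge0 ?enorm_ge0 // ltW.
rewrite lt_neqAle sumr_ge0 // andbT eq_sym psumr_eq0 //; apply/negP => /allP I0.
have qc i : q i = center_of_mass m q.
  have := I0 i (mem_index_enum i).
  by rewrite /= mulf_eq0 (gt_eqF (m_gt0 i)) sqrf_eq0 enorm_eq0 subr_eq0 => /eqP.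
by have /q_inj := etrans (qc ord0) (esym (qc ord_max)).
Qed.

Lemma lambda_gt0 : 0 < lambda m q.
Proof. by rewrite divr_gt0 ?potential_gt0 ?inertia_gt0. Qed.

(** Pair the equation at [i] with [m i *: (q i - c)] and sum over [i]. The two terms of each pair of
    bodies add up to minus its share of the potential, so the left side is [- potential m q], while
    the right side is [- (K * total_mass m * inertia m q)]. *)
Lemma balanced_lambda K : balanced K m q -> K = lambda m q / total_mass m.
Proof.
move/(balancedE _ _ M0) => B; set c := center_of_mass m q in B.
pose f i j := m i * m j / enorm (q i - q j).
pose g i j := m i * m j / enorm (q j - q i) ^+ 3 * dot (q j - q i) (q i - c).
have fC i j : f i j = f j i by rewrite /f enormB (mulrC (m i)).
have f0 i : f i i = 0 by rewrite /f subrr (eqP (_ : enorm 0 == 0)) ?enorm_eq0 // invr0 mulr0.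
have gE i j : g i j + g j i = - f i j.
  have [qij|/negPf ij] := eqVneq (q j) (q i).
    by rewrite /g /f !qij !subrr !dot0l (eqP (_ : enorm 0 == 0)) ?enorm_eq0 // invr0; ring.
  have r0 : enorm (q j - q i) != 0 by rewrite enorm_eq0 subr_eq0 ij.
  rewrite /g /f (enormB (q i)); have := enorm_sqr (q j - q i).
  set r := enorm _ in r0 *; rewrite !dotlin (dotC (q i) (q j)) => r2.
  have {}r2 : 2 * dot (q j) (q i) = dot (q j) (q j) + dot (q i) (q i) - r ^+ 2.
    by rewrite r2; ring.
  transitivity (m i * m j / r ^+ 3 *
    (2 * dot (q j) (q i) - dot (q j) (q j) - dot (q i) (q i))); first by ring.
  by rewrite r2; field.
have sg : \sum_i \sum_j g i j = - potential m q.
  have : \sum_i \sum_j g i j + \sum_i \sum_j g i j = - \sum_i \sum_j f i j.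
    rewrite {2}exchange_big -big_split /= -sumrN; apply: eq_bigr => i _.
    by rewrite -big_split -sumrN; apply: eq_bigr => j _; rewrite /= gE.
  rewrite (sum_pairs fC f0) -[X in 2 * X]/(potential m q); lra.
have sI : \sum_i \sum_j g i j = - (K * total_mass m * inertia m q).
  rewrite /inertia mulr_sumr -sumrN; apply: eq_bigr => i _.
  transitivity (m i * dot (\sum_j (m j / enorm (q j - q i) ^+ 3) *: (q j - q i)) (q i - c)).
    by rewrite dot_suml mulr_sumr; apply: eq_bigr => j _; rewrite dotZl /g; ring.
  by rewrite B dotZl -(opprB (q i)) dotNl enorm_sqr; ring.
have I0 := lt0r_neq0 inertia_gt0.
have U : potential m q = K * total_mass m * inertia m q by lra.
by rewrite /lambda U; field; rewrite I0 M0.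
Qed.

(** Since the multiplier is forced, centrality can be checked with whatever [K] solves the
    equations, without computing the potential or the inertia. *)
Lemma centralP : central m q <-> exists K, balanced K m q.
Proof.
split=> [/(central_balanced _ m_gt0 M0)|[K B]]; first by exists (lambda m q / total_mass m).
by apply/central_balanced => //; rewrite -(balanced_lambda B).
Qed.

Lemma r0_gt0 : 0 < r0 m q.
Proof. by rewrite powR_gt0 // divr_gt0 ?total_mass_gt0 ?lambda_gt0. Qed.

Lemma balanced_r0 K : balanced K m q -> K = (r0 m q ^+ 3)^-1.
Proof.
have P : 0 <= total_mass m / lambda m q.
  by rewrite divr_ge0 ?ltW ?total_mass_gt0 ?lambda_gt0.
move/balanced_lambda => ->; rewrite /r0 -powR_mulrn ?powR_ge0 // -powRrM.
by rewrite mulVf ?pnatr_eq0 // powRr1 // -[LHS]invrK invf_div.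
Qed.

End Lambda.

(** * Labellings of four bodies *)

Lemma exists_notin (s : seq 'I_4) : (size s < 4)%N -> exists x, x \notin s.
Proof.
move=> s4; apply/existsP; rewrite -negb_forall; apply: contraL s4 => /forallP s_all.
by rewrite -leqNgt -{1}(card_ord 4) cardE uniq_leq_size ?enum_uniq.
Qed.

Lemma exists_rest (i j : 'I_4) : i != j -> exists k l, uniq [:: i; j; k; l].
Proof.
move=> ij; have [k] := @exists_notin [:: i; j] isT.
have [l] := @exists_notin [:: i; j; k] isT.
rewrite !inE !negb_or => /and3P[li lj lk] /andP[ki kj]; exists k, l.
by rewrite /= !inE !negb_or ij (eq_sym i k) (eq_sym i l) (eq_sym j k)
  (eq_sym j l) (eq_sym k l) ki kj li lj lk.
Qed.

Lemma mem_uniq4 (i j k l : 'I_4) : uniq [:: i; j; k; l] -> forall x, x \in [:: i; j; k; l].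
Proof.
move=> u x; apply: contraT => xn.
have : (size [:: x; i; j; k; l] <= size (enum 'I_4))%N.
  by apply: uniq_leq_size => [|y _]; rewrite ?mem_enum // cons_uniq xn.
by rewrite -cardE card_ord.
Qed.

Lemma big_uniq4 (V : nmodType) (F : 'I_4 -> V) (i j k l : 'I_4) :
  uniq [:: i; j; k; l] -> \sum_x F x = F i + (F j + (F k + F l)).
Proof.
move=> u; have -> : \sum_x F x = \sum_(x <- [:: i; j; k; l]) F x.
  apply: perm_big; apply: uniq_perm; rewrite ?index_enum_uniq // => x.
  by rewrite mem_index_enum mem_uniq4.
by rewrite !big_cons big_nil addr0.
Qed.

(** * Affine relations between four points of a sphere *)

Section Sphere.
Context {R : realType} (q : 'I_4 -> 'rV[R]_3) (p : 'rV[R]_3) (rho : R).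
Hypotheses (q_inj : injective q) (on_sphere : forall i, enorm (q i - p) = rho).

Local Notation D i j := (dist q i j ^+ 2).

Lemma sqdistE i j : D i j = 2 * rho ^+ 2 - 2 * dot (q i - p) (q j - p).
Proof.
rewrite /dist -(subrKA p (q j)) -(opprB (q i)).
have := enorm_sqr (q i - p); have := enorm_sqr (q j - p).
rewrite !on_sphere enorm_sqr; move: (q i - p) (q j - p) => u v.
by rewrite !dotlin (dotC v u); lra.
Qed.

Let D_gt0 i j : i != j -> 0 < D i j.
Proof. by move=> ij; rewrite exprn_gt0 // dist_gt0. Qed.

Let Dii i : D i i = 0. Proof. by rewrite dist0 expr0n. Qed.

Definition relation (a : 'I_4 -> R) := \sum_j a j = 0 /\ \sum_j a j *: q j = 0.

(** By [sqdistE], [D i j] is an affine function of [q j] on the sphere, and an affine relation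
    annihilates affine functions. *)
Lemma relation_sqdist a : relation a -> forall i, \sum_j a j * D i j = 0.
Proof.
move=> [a0 aq] i.
transitivity (2 * rho ^+ 2 * (\sum_j a j)
    - 2 * dot (\sum_j a j *: q j - (\sum_j a j) *: p) (q i - p)).
  rewrite mulr_sumr scaler_suml -sumrB dot_suml mulr_sumr -sumrB.
  apply: eq_bigr => j _; rewrite sqdistE (dotC (q i - p)) -scalerBr dotZl; ring.
by rewrite a0 aq scale0r subr0 dot0l; ring.
Qed.

(* A line meets the sphere in at most two points, so no three of the four
   points are collinear. *)
Lemma relation_eq0 a l : relation a -> a l = 0 -> forall i, a i = 0.
Proof.
move=> ra al i; have [-> //|il] := eqVneq i l.
have [j [k u]] := exists_rest il; have /and5P[] := u; rewrite !inE !negb_or.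
move=> /and3P[_ ij ik] /andP[lj lk] jk _ _.
have := relation_sqdist ra i; have := relation_sqdist ra j; have := relation_sqdist ra k.
rewrite !(big_uniq4 _ u) al !Dii (distC q k i) (distC q k j) (distC q j i).
have := D_gt0 ij; have := D_gt0 ik; have := D_gt0 jk.
move: (D i j) (D i k) (D j k) => x y z z0 y0 x0 Ek Ej Ei.
(* The equations at [i], [j], [k] form a symmetric system with zero diagonal; the combination below
   eliminates [a j] and [a k]. *)
have E : a i * (y * x) = 0.
  have : 2 * (a i * (y * x)) = x * (a i * y + (0 * D k l + (a j * z + a k * 0)))
    + y * (a i * x + (0 * D j l + (a j * 0 + a k * z)))
    - z * (a i * 0 + (0 * D i l + (a j * x + a k * y))) by ring.
  by rewrite Ek Ej Ei; lra.
by move/eqP: E; rewrite !mulf_eq0 (gt_eqF x0) (gt_eqF y0) !orbF => /eqP.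
Qed.

End Sphere.

Lemma invX3_lt (R : realType) (x y : R) : 0 < x -> 0 < y ->
  ((x ^+ 3)^-1 < (y ^+ 3)^-1) = (y < x).
Proof. by move=> x0 y0; rewrite ltf_pV2 ?posrE ?exprn_gt0 // ltr_pXn2r ?nnegrE ?ltW. Qed.

(** * Sides and diagonals of a balanced configuration on a sphere *)

Section SphericalBalanced.
Context {R : realType} (m : 'I_4 -> R) (q : 'I_4 -> 'rV[R]_3) (p : 'rV[R]_3) (rho s : R).
Hypotheses (m_gt0 : forall i, 0 < m i) (q_inj : injective q).
Hypotheses (on_sphere : forall i, enorm (q i - p) = rho).
Hypotheses (s_gt0 : 0 < s) (q_bal : balanced (s ^+ 3)^-1 m q).

Local Notation d := (dist q).
Local Notation S := (excess (s ^+ 3)^-1 q).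
Let stress i j := m i * m j * S i j.
Let row i j := if j == i then - \sum_(x | x != i) stress i x else stress i j.

Let d_gt0 := dist_gt0 q_inj.

Let rowC i j : row i j = row j i.
Proof.
rewrite /row eq_sym; case: eqVneq => [->|_] //.
by rewrite /stress /excess (distC q j) (mulrC (m i)).
Qed.

Let rowE i j : i != j -> row i j = stress i j.
Proof. by rewrite /row eq_sym => /negPf ->. Qed.

Let row_relation i : relation q (row i).
Proof.
have off : \sum_(j | j != i) row i j = \sum_(x | x != i) stress i x.
  by apply: eq_bigr => j /negPf ji; rewrite /row ji.
have r0 : \sum_j row i j = 0 by rewrite (bigD1 i) //= off /row eqxx addNr.
split=> //.
have : \sum_j row i j *: (q j - q i) = 0.
  transitivity (m i *: \sum_j (m j * S i j) *: (q j - q i)); last by rewrite q_bal scaler0.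
  rewrite scaler_sumr; apply: eq_bigr => j _; rewrite scalerA mulrA /row.
  by case: eqVneq => [->|//]; rewrite subrr !scaler0.
under eq_bigr do rewrite scalerBr; rewrite sumrB -scaler_suml.
by rewrite r0 scale0r subr0.
Qed.

(** The combination of rows [i] and [k] that cancels column [c] is again an affine relation, with a
    vanishing coefficient, hence trivial. *)
Let rank1 i k c j : row i c * row k j = row k c * row i j.
Proof.
pose a x := row i c * row k x - row k c * row i x.
have [[i0 iq] [k0 kq]] := (row_relation i, row_relation k).
have ra : relation q a.
  split; first by rewrite sumrB -!mulr_sumr i0 k0 !mulr0 subrr.
  transitivity (row i c *: (\sum_x row k x *: q x) - row k c *: (\sum_x row i x *: q x)).
    by rewrite !scaler_sumr -sumrB; apply: eq_bigr => x _; rewrite !scalerA scalerBl.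
  by rewrite iq kq !scaler0 subrr.
have ac : a c = 0 by rewrite /a mulrC subrr.
by have /eqP := relation_eq0 q_inj on_sphere ra ac j; rewrite subr_eq0 => /eqP.
Qed.

Let row_gt0 i j : i != j -> (0 < row i j) = (d i j < s).
Proof.
move=> ij; rewrite rowE // /stress pmulr_rgt0 ?mulr_gt0 //.
by rewrite subr_gt0 invX3_lt ?d_gt0.
Qed.

Let row_lt0 i j : i != j -> (row i j < 0) = (s < d i j).
Proof.
move=> ij; rewrite rowE // /stress pmulr_rlt0 ?mulr_gt0 //.
by rewrite subr_lt0 invX3_lt ?d_gt0.
Qed.

(** One zero entry kills its whole row; by symmetry every row then has a zero in column [x], so the
    matrix vanishes. *)
Let row_eq0 x y : row x y = 0 -> forall i j, i != j -> d i j = s.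
Proof.
move=> xy i j ij; have rx := relation_eq0 q_inj on_sphere (row_relation x) xy.
have rij : row i j = 0.
  apply: (relation_eq0 q_inj on_sphere (row_relation i) (l := x)).
  by rewrite rowC rx.
have := row_gt0 ij; have := row_lt0 ij; rewrite rij ltxx.
by case: ltgtP.
Qed.

(** If no entry of the matrix vanishes, it is symmetric of rank one with negative diagonal, so its
    signs split the four bodies into two classes. The relations leave only two classes of two
    bodies: pairs within a class are the diagonals, pairs across are the sides. *)
Lemma spherical_balanced :
  (forall i j, i != j -> d i j = s) \/
  exists i j k l, [/\ uniq [:: i; j; k; l],
    [/\ d i j < s, d j k < s, d k l < s & d l i < s],
    s < d i k, s < d j l & S i j * S k l = S j k * S l i].
Proof.
have [/existsP[x /existsP[y /eqP xy]]|] := boolP [exists x, exists y, row x y == 0].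
  by left; apply: row_eq0 xy.
rewrite negb_exists => /forallP nz0; right.
have {nz0} nz x y : row x y != 0.
  by have := nz0 x; rewrite negb_exists => /forallP /(_ y).
have sq i j : i != j -> row i j * (d i j ^+ 2 - s ^+ 2) < 0.
  move=> ij; have := row_gt0 ij; have := row_lt0 ij; have := nz i j.
  have -> : d i j ^+ 2 - s ^+ 2 = (d i j - s) * (d i j + s) by ring.
  have := d_gt0 ij => dij; rewrite mulrA pmulr_llt0 ?addr_gt0 //.
  by case: (ltgtP (row i j) 0) => // r _ /esym sd /esym ds;
    [rewrite nmulr_rlt0 ?subr_gt0 | rewrite pmulr_rlt0 ?subr_lt0].
(* The sum of [row i j * (d i j ^+ 2 - s ^+ 2)] over [j] is [0], and its terms
   with [j != i] are negative. *)
have diag i : row i i < 0.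
  have : \sum_j row i j * (d i j ^+ 2 - s ^+ 2) = 0.
    under eq_bigr do rewrite mulrBr; rewrite sumrB -mulr_suml.
    by rewrite (row_relation i).1 mul0r subr0 (relation_sqdist on_sphere).
  rewrite (bigD1 i) //= {1}/dist subrr enorm_sqr dot0l sub0r => E.
  have : \sum_(j | j != i) row i j * (d i j ^+ 2 - s ^+ 2) <= 0.
    by apply: sumr_le0 => j; rewrite eq_sym => /sq/ltW.
  have s2 : 0 < s ^+ 2 by rewrite exprn_gt0.
  by move=> le0; rewrite lt_neqAle nz -(pmulr_lle0 _ s2); lra.
have [j ij] := exists_notin (isT : (size [:: ord0 : 'I_4] < 4)%N).
rewrite inE eq_sym in ij; set i := ord0 in ij.
have [k [l u]] := exists_rest ij.
(* Once [k] is known to be opposite to [i], the remaining signs follow from the vanishing minors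
   containing the negative entry [row i i]. *)
have conclude j' k' l' : uniq [:: i; j'; k'; l'] ->
    0 < row i j' -> row i k' < 0 -> 0 < row i l' -> exists i j k l, [/\ uniq [:: i; j; k; l],
    [/\ d i j < s, d j k < s, d k l < s & d l i < s],
    s < d i k, s < d j l & S i j * S k l = S j k * S l i].
  clear j k l ij u; move: j' k' l' => j k l u ij ik il.
  have /and5P[] := u; rewrite !inE !negb_or.
  move=> /and3P[nij nik nil] /andP[njk njl] nkl _ _.
  have [ki li] : k != i /\ l != i by rewrite !(eq_sym _ i).
  have jk : 0 < row j k.
    by rewrite -(nmulr_rlt0 _ (diag i)) rank1 (rowC j) pmulr_rlt0.
  have jl : row j l < 0.
    by rewrite -(nmulr_rgt0 _ (diag i)) rank1 (rowC j) pmulr_rgt0.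
  have kl : 0 < row k l.
    by rewrite -(nmulr_rlt0 _ (diag i)) rank1 (rowC k) nmulr_rlt0.
  exists i, j, k, l; split=> //.
  - split; rewrite -row_gt0 //; by rewrite rowC.
  - by rewrite -row_lt0.
  - by rewrite -row_lt0.
  have := rank1 i k j l; rewrite (rowC k j) (rowC i l) !rowE // /stress => E.
  have M : m i * m j * m k * m l != 0 by rewrite !mulf_neq0 ?gt_eqF.
  apply: (mulfI M).
  transitivity (m i * m j * S i j * (m k * m l * S k l)); first by ring.
  by rewrite E; ring.
have /and5P[] := u; rewrite !inE !negb_or => /and3P[_ ik il] /andP[jk jl] kl _ _.
have neg3 (a b c x y z : R) : a < 0 -> b < 0 -> c < 0 -> 0 < x -> 0 < y -> 0 < z ->
    a * x + (b * y + c * z) = 0 -> False.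
  move=> a0 b0 c0 x0 y0 z0; have := nmulr_rlt0 x a0; have := nmulr_rlt0 y b0.
  by have := nmulr_rlt0 z c0; rewrite x0 y0 z0; lra.
have D0 x y : x != y -> 0 < d y x ^+ 2.
  by move=> xy; rewrite exprn_gt0 // dist_gt0 // eq_sym.
have r0 := (row_relation i).1; have rD := relation_sqdist on_sphere (row_relation i).
have := rD i; have := rD j; have := rD k; have := rD l; move: r0; rewrite !(big_uniq4 _ u).
rewrite !dist0 expr0n !mulr0 !add0r !addr0 => r0 Dl Dk Dj Di.
have ii := diag i.
(* Exactly one of the three entries is negative. Three are excluded by the zero row sum, two by the
   squared-distance relation at the body with the positive entry, none by that relation at [i]. *)
have [ri|ri|/eqP] := ltgtP (row i j) 0; last by rewrite (negPf (nz _ _)).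
- have [rk|rk|/eqP] := ltgtP (row i k) 0; last by rewrite (negPf (nz _ _)).
    have [rl|rl|/eqP] := ltgtP (row i l) 0; last by rewrite (negPf (nz _ _)).
      by exfalso; lra.
    by case: (neg3 _ _ _ _ _ _ ii ri rk (D0 _ _ il) (D0 _ _ jl) (D0 _ _ kl)).
  have [rl|rl|/eqP] := ltgtP (row i l) 0; last by rewrite (negPf (nz _ _)).
    by case: (neg3 _ _ _ _ _ _ ii ri rl (D0 _ _ ik) (D0 _ _ jk) (D0 l k _)); rewrite 1?eq_sym.
  apply: (conclude k j l) => //; move: u; rewrite /= !inE !negb_or (eq_sym k j).
  by rewrite ij ik il jk jl kl.
have [rk|rk|/eqP] := ltgtP (row i k) 0; last by rewrite (negPf (nz _ _)).
  have [rl|rl|/eqP] := ltgtP (row i l) 0; last by rewrite (negPf (nz _ _)).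
    by case: (neg3 _ _ _ _ _ _ ii rk rl (D0 _ _ ij) (D0 k j _) (D0 l j _)); rewrite 1?eq_sym.
  exact: (conclude j k l).
have [rl|rl|/eqP] := ltgtP (row i l) 0; last by rewrite (negPf (nz _ _)).
  apply: (conclude j l k) => //; move: u; rewrite /= !inE !negb_or (eq_sym l k).
  by rewrite ij ik il jk jl kl.
exfalso; apply: (neg3 (- row i j) (- row i k) (- row i l) _ _ _ _ _ _
  (D0 j i _) (D0 k i _) (D0 l i _)).
all: rewrite ?oppr_lt0 // 1?eq_sym //; lra.
Qed.
End SphericalBalanced.

(** * Weighted sums of distances on a sphere *)

Section SphereSums.
Context {R : realType} (m : 'I_4 -> R) (q : 'I_4 -> 'rV[R]_3) (p : 'rV[R]_3) (rho K : R).
Hypotheses (q_bal : balanced K m q) (on_sphere : forall i, enorm (q i - p) = rho).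

(** Take the inner product of the balance at [i] with [q i - p]: on the sphere, twice that of
    [q j - q i] with [q i - p] is minus the squared distance. *)
Lemma sum_excess_sqdist i : \sum_j m j * excess K q i j * dist q i j ^+ 2 = 0.
Proof.
have F : 2 * dot (\sum_j (m j * excess K q i j) *: (q j - q i)) (q i - p) = 0.
  by rewrite q_bal dot0l mulr0.
apply: oppr_inj; rewrite oppr0 -[RHS]F dot_suml mulr_sumr -sumrN; apply: eq_bigr => j _.
rewrite (sqdistE on_sphere) dotZl -(subrKA p (q j) (- q i)) -(opprB (q i) p) (dotBl (q j - p)).
by rewrite -enorm_sqr on_sphere (dotC (q i - p)); ring.
Qed.

Hypotheses (M0 : total_mass m != 0) (p_center : p = center_of_mass m q).

Lemma sum_mass_sqdist i : \sum_j m j * dist q i j ^+ 2 = 2 * total_mass m * rho ^+ 2.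
Proof.
transitivity (2 * total_mass m * rho ^+ 2 - 2 * dot (\sum_j m j *: (q j - p)) (q i - p)).
  rewrite dot_suml /total_mass !mulr_sumr !mulr_suml -sumrB; apply: eq_bigr => j _.
  by rewrite (sqdistE on_sphere) dotZl (dotC (q i - p)); ring.
by rewrite sum_from_point // p_center subrr scaler0 dot0l mulr0 subr0.
Qed.

Lemma sum_mass_invdist i : \sum_j m j / dist q i j = K * (2 * total_mass m * rho ^+ 2).
Proof.
rewrite -(sum_mass_sqdist i) mulr_sumr; apply/eqP; rewrite -subr_eq0 -sumrB; apply/eqP.
rewrite -[RHS](sum_excess_sqdist i); apply: eq_bigr => j _; rewrite /excess.
(* A zero distance, as for [j = i], contributes nothing to either sum, since the inverse of 0 is
   0. *)
have [->|d0] := eqVneq (dist q i j) 0; first by rewrite invr0; ring.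
by field.
Qed.

End SphereSums.

(** * Comparison of opposite bodies of a quadrilateral *)

Section OppositeBodies.
Context {R : realType} (s : R).

Local Notation S x := ((x ^+ 3)^-1 - (s ^+ 3)^-1).

(* [a], [b], [c], [d] are the successive sides of a quadrilateral whose
   diagonal [e] joins bodies of masses [m0] and [m2]; the equations compare
   the sums [sum_mass_sqdist] and [sum_mass_invdist] at these two bodies. *)
Definition opposite_bodies (a b c d e m0 m1 m2 m3 : R) : Prop :=
  [/\ [/\ 0 < a < s, 0 < b < s, 0 < c < s & 0 < d < s], [/\ 0 < e, 0 < m1 & 0 < m3],
    S a * S c = S b * S d,
    m1 * a ^+ 2 + (m2 * e ^+ 2 + m3 * d ^+ 2) = m0 * e ^+ 2 + (m1 * b ^+ 2 + m3 * c ^+ 2) &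
    m1 / a + (m2 / e + m3 / d) = m0 / e + (m1 / b + m3 / c)].

(** If [a < b], the product equation gives [d < c]. Then the squared distances require [m0 < m2] and
    the inverse distances require [m2 < m0]. *)
Lemma opposite_bodies_nlt a b c d e m0 m1 m2 m3 :
  opposite_bodies a b c d e m0 m1 m2 m3 -> a < b -> False.
Proof.
move=> [[/andP[a0 as_] /andP[b0 bs] /andP[c0 cs] /andP[d0 ds]] [e0 m10 m30] ES E2 E1] ab.
have s0 := lt_trans a0 as_.
have Sc0 : 0 < S c by rewrite subr_gt0 invX3_lt.
have Sb0 : 0 < S b by rewrite subr_gt0 invX3_lt.
have dc : d < c.
  rewrite -invX3_lt // -(ltrD2r (- (s ^+ 3)^-1)) -(ltr_pM2l Sb0) -[ltRHS]ES ltr_pM2r //.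
  by rewrite ltrD2r invX3_lt.
have : 0 < (m2 - m0) * e ^+ 2.
  have : 0 < m1 * (b ^+ 2 - a ^+ 2).
    by rewrite mulr_gt0 // subr_gt0 ltrXn2r // ltW.
  have : 0 < m3 * (c ^+ 2 - d ^+ 2).
    by rewrite mulr_gt0 // subr_gt0 ltrXn2r // ltW.
  lra.
have : (m2 - m0) / e < 0.
  have : 0 < m1 * (a^-1 - b^-1) by rewrite mulr_gt0 // subr_gt0 ltf_pV2.
  have : 0 < m3 * (d^-1 - c^-1) by rewrite mulr_gt0 // subr_gt0 ltf_pV2.
  lra.
by rewrite pmulr_llt0 ?invr_gt0 // pmulr_lgt0 ?exprn_gt0 //; case: ltgtP.
Qed.

Lemma opposite_bodies_eq a b c d e m0 m1 m2 m3 :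
  opposite_bodies a b c d e m0 m1 m2 m3 -> [/\ a = b, c = d & m0 = m2].
Proof.
move=> H; have ab : a = b.
  case: (ltgtP a b) => // [/(opposite_bodies_nlt H) // | ba]; exfalso.
  case: H => [[a0 b0 c0 d0] pos ES E2 E1].
  (* The same quadrilateral, seen from the other end of the diagonal. *)
  apply: (@opposite_bodies_nlt b a d c e m2 m1 m0 m3) ba; split=> //; lra.
case: H; rewrite -{}ab => -[/andP[a0 as_] _ /andP[c0 cs] /andP[d0 ds]] [e0 _ _] ES E2 E1.
have Sa : S a != 0 by rewrite gt_eqF // subr_gt0 invX3_lt // (lt_trans a0).
have /addIr/invr_inj/eqP := mulfI Sa ES.
rewrite eqrXn2 ?ltW // => /eqP cd; split=> //.
by apply: (mulIf (lt0r_neq0 (exprn_gt0 2 e0))); move: E2; rewrite cd; lra.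
Qed.

End OppositeBodies.

(** * A quadrilateral on a sphere around its center of mass is a square *)

Section ConcyclicCentered.
Context {R : realType} (m : 'I_4 -> R) (q : 'I_4 -> 'rV[R]_3) (rho s : R).
Hypotheses (m_gt0 : forall i, 0 < m i) (q_inj : injective q).
Hypotheses (s_gt0 : 0 < s) (q_bal : balanced (s ^+ 3)^-1 m q).
Hypothesis on_sphere : forall i, enorm (q i - center_of_mass m q) = rho.
Local Notation d := (dist q).
Local Notation S := (excess (s ^+ 3)^-1 q).

Let M0 : total_mass m != 0 := lt0r_neq0 (total_mass_gt0 m_gt0).

Let s2 := sum_mass_sqdist on_sphere M0 erefl.

Let s1 := sum_mass_invdist q_bal on_sphere M0 erefl.

Lemma adjacent_sides_eq (i j k l : 'I_4) : uniq [:: i; j; k; l] ->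
  [/\ d i j < s, d j k < s, d k l < s & d l i < s] -> S i j * S k l = S j k * S l i ->
  [/\ d i j = d j k, d k l = d l i & m i = m k].
Proof.
move=> u [as_ bs cs gs] ES; have d0 := dist_gt0 q_inj.
have /and5P[] := u; rewrite !inE !negb_or => /and3P[ij ik il] /andP[jk jl] kl _ _.
apply: (@opposite_bodies_eq _ s _ _ _ _ (d i k) _ (m j) _ (m l)); split.
- by rewrite as_ bs cs gs !d0 // eq_sym.
- by split; rewrite ?d0.
- exact: ES.
- have := etrans (s2 i) (esym (s2 k)); rewrite !(big_uniq4 _ u) !dist0 expr0n !mulr0 !add0r.
  by rewrite (distC _ l i) (distC _ k j) (distC _ k i).
have := etrans (s1 i) (esym (s1 k)); rewrite !(big_uniq4 _ u) !dist0 invr0 !mulr0 !add0r.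
by rewrite (distC _ l i) (distC _ k j) (distC _ k i).
Qed.

(** Comparing opposite bodies along both diagonals makes all sides equal and opposite masses equal.
    The balance at [i] and [k] then yields a parallelogram centered at [c]; equal sides make its
    half-diagonals orthogonal, and the sphere makes them equal. Comparing adjacent bodies finally
    equates all masses. *)
Lemma centered_square_of_sides (i j k l : 'I_4) : uniq [:: i; j; k; l] ->
  [/\ d i j < s, d j k < s, d k l < s & d l i < s] -> S i j * S k l = S j k * S l i ->
  [/\ forall x y, m x = m y, is_square q & center_of_mass m q = centroid q].
Proof.
move=> u sides ES.
have opp_eq0 (x y z : R) : z = x - 2 * y -> z = x - 2 * - y -> y = 0 by lra.
(* Here [x], [y] are the two masses, and [a], [e] the inverses of the side and of the diagonal. *)
have diff_eq0 (x y a e : R) :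
    x * 0 + (y * a + (x * e + y * a)) = x * a + (y * 0 + (x * a + y * e)) ->
    (y - x) * (2 * a - e) = 0 by lra.
have [ab cd mik] := adjacent_sides_eq u sides ES.
have [_ ad mjl] : [/\ d j k = d k l, d l i = d i j & m j = m l].
  case: sides => *; apply: adjacent_sides_eq; last by rewrite [RHS]mulrC.
    by rewrite -[_ :: _]/(rot 1 [:: i; j; k; l]) rot_uniq.
  by split.
case: sides => as_ _ _ _; have d0 := dist_gt0 q_inj.
have /and5P[] := u; rewrite !inE !negb_or => /and3P[ij ik il] /andP[jk jl] kl _ _.
have [dji dki djk] : [/\ d j i = d i j, d k i = d i k & d j k = d i j].
  by split=> //; apply: distC.
have [dil dkj dkl] : [/\ d i l = d i j, d k j = d i j & d k l = d i j].
  by rewrite (distC _ i l) (distC _ k j) cd ad -ab.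
set c := center_of_mass m q.
have [v vE] : exists v, forall x, v x = q x - c by exists (fun x => q x - c).
have Cv : m i *: (v i + v k) + m j *: (v j + v l) = 0.
  have := sum_from_point q c M0; rewrite -/c subrr scaler0 (big_uniq4 _ u) -!vE.
  by rewrite -mik -mjl !scalerDr; move=> <-; rewrite addrACA !addrA.
pose t := m j * S i j; pose w := m i * S i k.
have vq x y : q x - q y = v x - v y by rewrite !vE opprB addrA subrK.
have Bi : t *: (v j - v i) + w *: (v k - v i) + t *: (v l - v i) = 0.
  have := q_bal i; rewrite (big_uniq4 _ u) subrr scaler0 add0r => <-.
  by rewrite !vq -mik -mjl /t /w /excess dil !addrA.
have Bk : w *: (v i - v k) + t *: (v j - v k) + t *: (v l - v k) = 0.
  have := q_bal k; rewrite (big_uniq4 _ u) subrr scaler0 add0r => <-.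
  by rewrite !vq -mjl /t /w /excess dkj dkl dki !addrA.
have Sij : 0 < S i j by rewrite subr_gt0 invX3_lt // d0.
have t0 : 0 < t by rewrite mulr_gt0.
have wt : w = - t.
  have : (2 * (w + t)) *: (v k - v i) = 0.
    transitivity (0 - 0 : 'rV[R]_3); last by rewrite subrr.
    by rewrite -{1}Bi -Bk; apply/rowP => x; rewrite !mxE; ring.
  move/eqP; rewrite scaler_eq0 -vq subr_eq0 (inj_eq q_inj) (eq_sym k) (negPf ik) orbF.
  by rewrite mulf_eq0 pnatr_eq0 /= addr_eq0 => /eqP.
have par : v j + v l = v i + v k.
  apply/eqP; rewrite -subr_eq0 -(inj_eq (scalerI (lt0r_neq0 t0))) scaler0 -Bi wt.
  by apply/eqP/rowP => x; rewrite !mxE; ring.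
have vki : v k = - v i.
  move/eqP: Cv; rewrite par -scalerDl scaler_eq0 gt_eqF ?addr_gt0 //= addrC addr_eq0.
  by move/eqP.
have vlj : v l = - v j.
  by move: par; rewrite vki subrr addrC => /eqP; rewrite addr_eq0 => /eqP.
have De x y : d x y ^+ 2 = 2 * rho ^+ 2 - 2 * dot (v x) (v y) by rewrite (sqdistE on_sphere) !vE.
have rv x : dot (v x) (v x) = rho ^+ 2 by rewrite -enorm_sqr vE on_sphere.
have vij : dot (v i) (v j) = 0.
  by apply: (opp_eq0 _ _ _ (De i j)); rewrite -dotNr -vlj -De dil.
have ef : d i k = d j l.
  by apply/eqP; rewrite -(@eqrXn2 _ 2) ?ltW ?d0 // !De vki vlj !dotNr !rv.
have e2 : d i k ^+ 2 = 2 * d i j ^+ 2.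
  by rewrite !De vki dotNr rv vij; ring.
have a0 := d0 _ _ ij.
have mij : m i = m j.
  have : (m j - m i) * (2 / d i j - (d i k)^-1) = 0.
    have := etrans (s1 i) (esym (s1 j)); rewrite !(big_uniq4 _ u) !dist0 !invr0.
    by rewrite dji dil djk -ef -mik -mjl => /diff_eq0.
  move/eqP; rewrite mulf_eq0 subr_eq0 => /orP[/eqP -> //|].
  (* The second factor vanishes only if the diagonal is half the side, against [e2]. *)
  rewrite subr_eq0 => /eqP E; exfalso.
  have : d i k = d i j / 2 by rewrite -[LHS]invrK -E invf_div.
  move=> ea; move: e2; rewrite ea; have := exprn_gt0 2 a0; lra.
have mall x : m x = m i.
  by have := mem_uniq4 u x; rewrite !inE => /or4P[] /eqP -> //; rewrite -mjl.
split=> [x y||]; first by rewrite !mall.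
  exists i, j, k, l; split=> //; split; first by rewrite (inj_eq q_inj).
  - by rewrite !vq vki vlj opprK addrC.
  - by rewrite !vq vlj !dotlin !rv vij (dotC (v j)) vij; ring.
  - by rewrite -[LHS]/(d i j) -dil.
rewrite /centroid.
have : \sum_x (q x - c) = 0.
  by rewrite (big_uniq4 _ u) -!vE vki vlj [v j + _]addrCA subrr addr0 subrr.
rewrite sumrB sumr_const card_ord => /eqP; rewrite subr_eq0 => /eqP.
by move=> ->; rewrite -scaler_nat scalerA mulVf ?pnatr_eq0 // scale1r.
Qed.

End ConcyclicCentered.

(** * Gram matrix obstructions and the bound on the radius *)

Lemma no_four_equiangular (R : realType) (v : 'I_4 -> 'rV[R]_3) (g h : R) :
  0 < h -> 0 <= g -> (forall i j, i != j -> dot (v i) (v j) = g) ->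
  (forall i, dot (v i) (v i) = g + h) -> False.
Proof.
move=> h0 g0 vij vii; have [a [i ai] av] := exists_relation v.
(* The Gram matrix, [h] times the identity plus the constant [g], is positive definite, whereas four
   vectors in dimension three are dependent. Pairing the dependence with [v k] gives this equation;
   summing over [k] kills the sum of the coefficients, then each coefficient. *)
have E k : a k * h = - (g * \sum_j a j).
  have : \sum_j (a j * dot (v j) (v k) - g * a j) = a k * h.
    rewrite (bigD1 k) //= vii big1 => [|j jk]; first by ring.
    by rewrite vij //; ring.
  rewrite sumrB -mulr_sumr => <-; rewrite -[RHS]add0r; congr (_ + _).
  rewrite -[RHS](dot0l (v k)) -av dot_suml.
  by apply: eq_bigr => j _; rewrite dotZl.
have : \sum_k a k * h = - (4 * g * \sum_j a j).
  rewrite (eq_bigr _ (fun k _ => E k)) sumr_const card_ord -mulr_natl; ring.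
rewrite -mulr_suml => /eqP; rewrite -subr_eq0 opprK.
have -> : (\sum_k a k) * h + 4 * g * \sum_j a j = (h + 4 * g) * \sum_j a j by ring.
rewrite mulf_eq0 gt_eqF /=; last by lra.
move=> /eqP a0; move: (E i); rewrite a0 mulr0 oppr0 => /eqP.
by rewrite mulf_eq0 (negPf ai) gt_eqF.
Qed.

Lemma five_equidistant (R : realType) (q : 'I_4 -> 'rV[R]_3) (p : 'rV[R]_3) (s : R) :
  0 < s -> (forall i, enorm (q i - p) = s) ->
  (forall i j, i != j -> dist q i j = s) -> False.
Proof.
move=> s0 qp qq; have s2 := exprn_gt0 2 s0.
apply: (@no_four_equiangular _ (fun i => q i - p) (s ^+ 2 / 2) (s ^+ 2 / 2)) => [||i j ij|i].
- by lra.
- by lra.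
- by have := sqdistE qp i j; rewrite qq //; lra.
by rewrite -enorm_sqr qp; lra.
Qed.

Lemma planar_not_tetrahedron (R : realType) (q : 'I_4 -> 'rV[R]_3) (o nu : 'rV[R]_3) (r s : R) :
  0 < s -> is_circle o nu r -> (forall i, on_circle o nu r (q i)) ->
  (forall i j, i != j -> dist q i j = s) -> False.
Proof.
move=> s0 [nu1 r0] qo qq; have s2 := exprn_gt0 2 s0.
have qr i : enorm (q i - o) = r by case: (qo i).
have qnu i : dot (q i - o) nu = 0 by case: (qo i).
have nn : dot nu nu = 1 by rewrite -enorm_sqr nu1 expr1n.
have gii i : dot (q i - o) (q i - o) = r ^+ 2 by rewrite -enorm_sqr qr.
have gij i j : i != j -> dot (q i - o) (q j - o) = r ^+ 2 - s ^+ 2 / 2.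
  by move=> ij; have := sqdistE qr i j; rewrite qq //; lra.
(* Moving the four coplanar points along [nu] makes their Gram matrix
   [s ^+ 2 / 2] times the identity plus a nonnegative constant. *)
apply: (@no_four_equiangular _ (fun i => q i - o + s *: nu)
  (r ^+ 2 + s ^+ 2 / 2) (s ^+ 2 / 2)) => [||i j ij|i].
- by lra.
- by have := exprn_gt0 2 r0; lra.
- by rewrite dotDl !(dotDr (q j - o)) gij // !dotZl !dotZr (dotC nu (q j - o)) !qnu nn; field.
by rewrite dotDl !(dotDr (q i - o)) gii // !dotZl !dotZr (dotC nu (q i - o)) !qnu nn; field.
Qed.

(* If [r0 < r], all pairs of vertices subtend acute angles at the center, and
   some vertex (say the second, with inner products [x] and [y] with its two
   neighbours) lies on the far side of the diagonal ([z]) of its neighbours. *)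
Lemma acute_gram_contradiction (R : realType) (a x y z : R) :
  a * a * a + 2 * x * y * z = a * y ^+ 2 + a * z ^+ 2 + a * x ^+ 2 ->
  0 < x <= a -> 0 < y <= a -> z < x -> z < y -> x + y <= a + z -> False.
Proof.
move=> G /andP[x0 xa] /andP[y0 ya] zx zy xyz.
(* The Gram equation in terms of [x + y] and [x - y]. Bounding these by [a + z] and [a - z] makes
   the right side strictly smaller than the left. *)
have E : (a - z) * (a + z) * 2 * a = (x + y) ^+ 2 * (a - z) + (x - y) ^+ 2 * (a + z).
  have -> : (x + y) ^+ 2 * (a - z) + (x - y) ^+ 2 * (a + z)
    = 2 * (a * y ^+ 2 + a * z ^+ 2 + a * x ^+ 2) - 2 * a * z ^+ 2 - 4 * x * y * z by ring.
  by rewrite -G; ring.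
have P : (x + y) ^+ 2 <= (a + z) ^+ 2 by rewrite ler_pXn2r ?nnegrE //; lra.
have Q : (x - y) ^+ 2 < (a - z) ^+ 2.
  rewrite -subr_gt0 subr_sqr mulr_gt0 //; lra.
have : (x + y) ^+ 2 * (a - z) <= (a + z) ^+ 2 * (a - z) by rewrite ler_wpM2r //; lra.
have : (x - y) ^+ 2 * (a + z) < (a - z) ^+ 2 * (a + z) by rewrite ltr_pM2r //; lra.
have : (a - z) * (a + z) * 2 * a = (a + z) ^+ 2 * (a - z) + (a - z) ^+ 2 * (a + z) by ring.
lra.
Qed.

(** This makes the square root in the height genuine. If [s < r], project the balance at [i] on
    [v i + v k]: the terms of [i] and [k] vanish, while [j] and [l] lie beyond the diagonal and are
    closer than [s] to [i], so they contribute positively. *)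
Lemma cocircular_radius_le (R : realType) (m : 'I_4 -> R) (q : 'I_4 -> 'rV[R]_3)
  (o nu : 'rV[R]_3) (r s : R) :
  (forall i, 0 < m i) -> injective q -> 0 < s -> balanced (s ^+ 3)^-1 m q ->
  is_circle o nu r -> (forall i, on_circle o nu r (q i)) -> r <= s.
Proof.
move=> m_gt0 q_inj s0 q_bal circ qo; rewrite leNgt; apply/negP => sr.
have [nu1 r0] := circ.
have qr i : enorm (q i - o) = r by case: (qo i).
have qnu i : dot (q i - o) nu = 0 by case: (qo i).
have nu0 : nu != 0 by rewrite -enorm_eq0 nu1 oner_eq0.
have [|] := spherical_balanced m_gt0 q_inj qr s0 q_bal.
  exact: planar_not_tetrahedron circ qo.
move=> [i [j [k [l [u [ij jk kl li] ik jl ES]]]]].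
have [v vE] : exists v, forall x, v x = q x - o by exists (fun x => q x - o).
have D x y : dist q x y ^+ 2 = 2 * r ^+ 2 - 2 * dot (v x) (v y) by rewrite !vE (sqdistE qr).
have vv x : dot (v x) (v x) = r ^+ 2 by rewrite -enorm_sqr vE qr.
have side x y : dist q x y < s -> 0 < dot (v x) (v y) <= r ^+ 2.
  move=> xy; have := D x y; have : dist q x y ^+ 2 < r ^+ 2.
    by rewrite ltrXn2r ?enorm_ge0 // (lt_trans xy).
  by have := sqr_ge0 (dist q x y); lra.
have longer x y x' y' : dist q x y < s -> s < dist q x' y' -> dot (v x') (v y') < dot (v x) (v y).
  move=> xy xy'; have := D x y; have := D x' y'.
  have : dist q x y ^+ 2 < dist q x' y' ^+ 2.
    by rewrite ltrXn2r ?enorm_ge0 // (lt_trans xy).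
  by lra.
have far (x : 'I_4) : dist q i x < s -> dist q x k < s ->
    0 < dot (v x) (v i + v k) - (r ^+ 2 + dot (v i) (v k)).
  move=> ix xk; rewrite ltNge; apply/negP => le0.
  have G := planar_gram nu0 (qnu i) (qnu x) (qnu k); rewrite -!vE !vv in G.
  apply: (acute_gram_contradiction G); rewrite ?side ?longer //.
  by move: le0; rewrite dotDr (dotC (v x) (v i)); lra.
have : dot (\sum_x (m x * excess (s ^+ 3)^-1 q i x) *: (q x - q i)) (v i + v k) = 0.
  by rewrite q_bal dot0l.
have term x : dot ((m x * excess (s ^+ 3)^-1 q i x) *: (q x - q i)) (v i + v k)
  = m x * excess (s ^+ 3)^-1 q i x * (dot (v x) (v i + v k) - (r ^+ 2 + dot (v i) (v k))).
  by rewrite dotZl -(subrKA o (q x)) -(opprB (q i)) -!vE dotBl (dotDr _ _ (v i)) vv.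
rewrite dot_suml (eq_bigr _ (fun x _ => term x)) (big_uniq4 _ u) !dotDr !vv (dotC (v k) (v i)).
rewrite (addrC (dot _ _) (r ^+ 2)) !subrr !mulr0 !add0r -!dotDr; apply/eqP; rewrite gt_eqF //.
have kl' : dist q l k < s by rewrite distC.
have li' : dist q i l < s by rewrite distC.
have E0 x : x != i -> dist q i x < s -> 0 < excess (s ^+ 3)^-1 q i x.
  by move=> xi ix; rewrite subr_gt0 invX3_lt // dist_gt0 // eq_sym.
have /and5P[] := u; rewrite !inE !negb_or => /and3P[nij nik nil] _ _ _ _.
by rewrite addr_gt0 // mulr_gt0 ?far // mulr_gt0 ?E0 // eq_sym.
Qed.

(** * Force balance on a line *)

Section CollinearForce.
Context {R : realType} (A B C : R).
Hypothesis C_gt0 : 0 < C.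

(** The coordinate [y] is measured from the attracting body: an inverse-square force and a linear
    one add up to the constant [A]. *)
Definition balance_point (y : R) : Prop := y != 0 /\ B * y + C * (y / `|y| ^+ 3) = A.

Let balance_norm y : balance_point y -> 0 < `|y| /\ B * `|y| + C / `|y| ^+ 2 = A * Num.sg y.
Proof.
case=> y0 <-; split; first by rewrite normr_gt0.
have n0 : `|y| != 0 by rewrite normr_eq0.
have yn : y = Num.sg y * `|y| by rewrite -numEsg.
have s2 : Num.sg y * Num.sg y = 1 by rewrite -expr2 sqr_sg y0.
have -> : y / `|y| ^+ 3 = Num.sg y / `|y| ^+ 2 by rewrite {1}yn; field.
transitivity ((Num.sg y * Num.sg y) * (B * `|y| + C / `|y| ^+ 2)); first by rewrite s2 mul1r.
have -> : B * y = B * (Num.sg y * `|y|) by rewrite -yn.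
by ring.
Qed.

(** On one side the balance depends only on the absolute value; subtract the two equations and
    divide by the difference of the absolute values. *)
Let same_side y z : balance_point y -> balance_point z -> y != z -> Num.sg y = Num.sg z ->
  B * (`|y| ^+ 2 * `|z| ^+ 2) = C * (`|y| + `|z|).
Proof.
move=> /balance_norm[y0 Ey] /balance_norm[z0 Ez] yz yzs.
have nyz : `|y| - `|z| != 0.
  by apply: contraNneq yz => /subr0_eq e; rewrite (numEsg y) (numEsg z) e yzs.
apply: (mulfI nyz).
have : B * `|y| + C / `|y| ^+ 2 - (B * `|z| + C / `|z| ^+ 2) = 0.
  by rewrite Ey Ez yzs subrr.
move: (`|y|) (`|z|) y0 z0 {Ey Ez nyz} => a b a0 b0 E.
apply/eqP; rewrite -subr_eq0; apply/eqP.
transitivity ((B * a + C / a ^+ 2 - (B * b + C / b ^+ 2)) * (a ^+ 2 * b ^+ 2)).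
  by field; rewrite !gt_eqF.
by rewrite E mul0r.
Qed.

Let same_side_pos y z : balance_point y -> balance_point z -> y != z -> Num.sg y = Num.sg z ->
  0 < B.
Proof.
move=> by_ bz yz s; have E := same_side by_ bz yz s.
have [[y0 _] [z0 _]] := (balance_norm by_, balance_norm bz).
by rewrite -(pmulr_lgt0 _ (mulr_gt0 (exprn_gt0 2 y0) (exprn_gt0 2 z0))) E mulr_gt0 ?addr_gt0.
Qed.

Let sg_balance y : 0 < B -> balance_point y -> Num.sg y = Num.sg A.
Proof.
move=> B0 by_; have [y0 E] := balance_norm by_.
have : 0 < A * Num.sg y by rewrite -E addr_gt0 ?mulr_gt0 ?invr_gt0 ?exprn_gt0.
case: by_ => yn _; case: sgrP => [y0'|_|_]; first by rewrite y0' eqxx in yn.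
  by rewrite mulr1 => /gtr0_sg ->.
by rewrite mulrN1 oppr_gt0 => /ltr0_sg ->.
Qed.

(** Two of three points share a side, which forces [0 < B]; then all three lie on the side of [A].
    For fixed [x], the equation of [same_side] has only one positive solution in the other absolute
    value. *)
Lemma at_most_two_balance_points x y z :
  balance_point x -> balance_point y -> balance_point z -> x != y -> x != z -> y != z -> False.
Proof.
move=> bx by_ bz xy xz yz.
have B0 : 0 < B.
  case: (bx) (by_) (bz) => x0 _ [y0 _] [z0 _].
  have [e|nxy] := eqVneq (Num.sg x) (Num.sg y); first exact: same_side_pos e.
  have [e|nxz] := eqVneq (Num.sg x) (Num.sg z); first exact: same_side_pos e.
  apply: (same_side_pos by_ bz) => //; move: x0 y0 z0 nxy nxz.
  by do 3![case: sgrP => //]; rewrite ?eqxx.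
have [sx [sy sz]] := (sg_balance B0 bx, (sg_balance B0 by_, sg_balance B0 bz)).
have Exy := same_side bx by_ xy (etrans sx (esym sy)).
have Exz := same_side bx bz xz (etrans sx (esym sz)).
have [[x0 _] [[y0 _] [z0 _]]] := (balance_norm bx, (balance_norm by_, balance_norm bz)).
have ab : `|y| = `|z|.
  move: (`|x|) (`|y|) (`|z|) x0 y0 z0 Exy Exz => a b c a0 b0 c0 Eb Ec.
  have : C * (b - c) * (a * b + a * c + b * c) = 0.
    transitivity (c ^+ 2 * (B * (a ^+ 2 * b ^+ 2)) * -1 + b ^+ 2 * (B * (a ^+ 2 * c ^+ 2))).
      by rewrite Eb Ec; ring.
    by ring.
  move/eqP; rewrite !mulf_eq0 (gt_eqF C_gt0) (gt_eqF (_ : 0 < a * b + a * c + b * c)) /=.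
    by rewrite orbF subr_eq0 => /eqP.
  by rewrite !addr_gt0 ?mulr_gt0.
by move/eqP: yz; apply; rewrite (numEsg y) (numEsg z) ab sy sz.
Qed.

End CollinearForce.

Lemma centroid_of_equal_masses (R : realType) (m : 'I_4 -> R) (q : 'I_4 -> 'rV[R]_3) :
  (forall i, 0 < m i) -> (forall i j, m i = m j) -> center_of_mass m q = centroid q.
Proof.
move=> m_gt0 meq; rewrite /center_of_mass /centroid /total_mass.
rewrite (eq_bigr (fun=> m ord0)) // sumr_const card_ord.
rewrite (eq_bigr (fun i => m ord0 *: q i)) => [|i _]; last by rewrite (meq i ord0).
rewrite -scaler_sumr scalerA -[m ord0 *+ 4]mulr_natl invfM -mulrA mulVf ?mulr1 //.
by rewrite gt_eqF.
Qed.

(** * Adding a fifth body to a balanced configuration *)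

Section FiveBodies.
Context {R : realType} (m : 'I_5 -> R) (q : 'I_5 -> 'rV[R]_3) (k : 'I_5) (K : R).
Hypotheses (m_gt0 : forall i, 0 < m i).
Let m' : 'I_4 -> R := remove k m.
Let q' : 'I_4 -> 'rV[R]_3 := remove k q.
Hypothesis q'_bal : balanced K m' q'.
Let M := total_mass m'.
Let c := center_of_mass m' q'.

Let m'_gt0 i : 0 < m' i. Proof. exact: m_gt0. Qed.

Let M0 : M != 0 := lt0r_neq0 (total_mass_gt0 m'_gt0).

Lemma five_balancedP K' : balanced K' m q <->
  \sum_j (m' j * ((enorm (q' j - q k) ^+ 3)^-1 - K')) *: (q' j - q k) = 0 /\
  forall i, ((K - K') * M) *: (c - q' i)
    + (m k * ((enorm (q' i - q k) ^+ 3)^-1 - K')) *: (q k - q' i) = 0.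
Proof.
have Ek : \sum_j (m j * excess K' q k j) *: (q j - q k)
    = \sum_j (m' j * ((enorm (q' j - q k) ^+ 3)^-1 - K')) *: (q' j - q k).
  by rewrite (bigD1_ord k) //= subrr scaler0 add0r.
have Ei i : \sum_j (m j * excess K' q (lift k i) j) *: (q j - q (lift k i))
    = ((K - K') * M) *: (c - q' i)
      + (m k * ((enorm (q' i - q k) ^+ 3)^-1 - K')) *: (q k - q' i).
  rewrite (bigD1_ord k) //= addrC /excess /dist (enormB (q k)); congr (_ + _).
  rewrite -scalerA -(sum_from_point _ _ M0) scaler_sumr -[LHS]subr0 -[X in _ - X](q'_bal i) -sumrB.
  apply: eq_bigr => j _; rewrite scalerA -scalerBl; congr (_ *: _).
  by rewrite /excess /dist /m' /q' /remove; ring.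
split=> [B|[Bk Bi] i]; first by split=> [|i]; [rewrite -Ek | rewrite -Ei]; apply: B.
by case: (unliftP k i) => [j|] ->; [apply: etrans (Ei j) (Bi j) | apply: etrans Ek Bk].
Qed.

Lemma equidistant_balanced s : K = (s ^+ 3)^-1 -> (forall i, enorm (q' i - q k) = s) ->
  balanced K m q.
Proof.
move=> Ks qs; apply/five_balancedP; split=> [|i].
  by apply: big1 => j _; rewrite qs Ks subrr mulr0 scale0r.
by rewrite qs Ks !subrr mulr0 mul0r !scale0r addr0.
Qed.

Lemma centered_balanced rho : q k = c -> (forall i, enorm (q' i - q k) = rho) ->
  exists K', balanced K' m q.
Proof.
move=> qc qr; pose x := (rho ^+ 3)^-1.
(* The solution [K'] of [(K - K') * M + m k * (x - K') = 0], the total coefficient of [c - q' i]. *)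
exists ((K * M + m k * x) / (M + m k)); apply/five_balancedP; split=> [|i].
  under eq_bigr do rewrite qr mulrC -scalerA.
  by rewrite -scaler_sumr sum_from_point // qc subrr !scaler0.
rewrite qr -/x qc -scalerDl (_ : _ + _ = 0) ?scale0r //.
have : M + m k != 0 by rewrite gt_eqF // addr_gt0 ?total_mass_gt0.
by move=> ?; field.
Qed.

Hypothesis q_inj : injective q.

Lemma five_balanced_cases K' : balanced K' m q ->
  (K' = K /\ forall i, (enorm (q' i - q k) ^+ 3)^-1 = K) \/
  (q k = c /\ exists rho, forall i, enorm (q' i - q k) = rho).
Proof.
move=> /five_balancedP[_ B].
have neq i : q k - q' i != 0.
  by rewrite subr_eq0 (inj_eq q_inj) neq_lift.
have [K'K|KK'] := eqVneq K' K.
  left; split=> // i; have /eqP := B i.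
  rewrite K'K subrr mul0r scale0r add0r scaler_eq0 (negPf (neq i)) orbF.
  by rewrite mulf_eq0 gt_eqF //= subr_eq0 => /eqP.
have a0 : (K - K') * M != 0 by rewrite mulf_neq0 // subr_eq0 eq_sym.
have [qc|qc] := eqVneq (q k) c.
  right; split=> //; exists (enorm (q' ord0 - q k)) => i.
  have coef j : (K - K') * M + m k * ((enorm (q' j - q k) ^+ 3)^-1 - K') = 0.
    by have /eqP := B j; rewrite -qc -scalerDl scaler_eq0 (negPf (neq j)) orbF => /eqP.
  have /addrI/(mulfI (lt0r_neq0 (m_gt0 k)))/addIr/invr_inj/eqP :=
    etrans (coef i) (esym (coef ord0)).
  by rewrite eqrXn2 ?enorm_ge0 // => /eqP.
(* Now every [q' i] lies on the line through [q k] directed by [w], with nonzero coordinate [y i];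
   three of these distinct coordinates already contradict the bound of two. *)
exfalso; pose w := c - q k; pose A := (K - K') * M.
have w0 : 0 < enorm w by rewrite enorm_gt0 subr_eq0 eq_sym.
pose co i := A + m k * ((enorm (q' i - q k) ^+ 3)^-1 - K').
have E i : A *: w = co i *: (q' i - q k).
  apply/eqP; rewrite -subr_eq0 -[X in _ == X](B i); apply/eqP.
  by rewrite /co /w; apply/rowP => x; rewrite !mxE -/A; ring.
have co0 i : co i != 0.
  apply: contraNneq (_ : A *: w != 0) => [c0|]; first by rewrite (E i) c0 scale0r.
  by rewrite scaler_eq0 negb_or a0 -enorm_eq0 gt_eqF.
pose y i := A / co i.
have qy i : q' i - q k = y i *: w.
  by rewrite /y mulrC -scalerA (E i) scalerA mulVf // scale1r.
have yinj i j : i != j -> y i != y j.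
  apply: contraNneq => yij; apply/eqP/(@lift_inj _ k)/q_inj/(addIr (- q k)).
  by have := qy i; rewrite yij -qy.
have bal i : balance_point A (A - m k * K') (m k / enorm w ^+ 3) (y i).
  have y0 : y i != 0 by rewrite mulf_neq0 ?invr_eq0.
  split=> //; have ny : `|y i| != 0 by rewrite normr_eq0.
  have w0' := lt0r_neq0 w0.
  have -> : m k / enorm w ^+ 3 * (y i / `|y i| ^+ 3)
    = m k * (enorm (q' i - q k) ^+ 3)^-1 * y i by rewrite qy enormZ; field; rewrite ny w0'.
  transitivity (co i * y i); first by rewrite /co; ring.
  by rewrite /y mulrC divfK.
have C0 : 0 < m k / enorm w ^+ 3 by rewrite divr_gt0 ?exprn_gt0.
exact: (at_most_two_balance_points C0 (bal 0) (bal 1) (bal 2%:R)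
  (yinj 0 1 isT) (yinj 0 2%:R isT) (yinj 1 2%:R isT)).
Qed.

End FiveBodies.

(** * The three types are central *)

Lemma square_balanced (R : realType) (m : 'I_4 -> R) (q : 'I_4 -> 'rV[R]_3) :
  (forall i j, m i = m j) -> is_square q ->
  (exists K, balanced K m q) /\ (exists rho, forall i, enorm (q i - centroid q) = rho).
Proof.
move=> meq [i [j [k [l [u [_ par orth sides]]]]]].
have [v vE] : exists v, forall x, v x = q x - centroid q by exists (fun x => q x - centroid q).
have cE : centroid q = 4%:R^-1 *: (q i + (q j + (q k + q l))) by rewrite /centroid (big_uniq4 _ u).
have ql : q l = q i + q k - q j.
  by rewrite -(subrK (q i) (q j)) par; apply/rowP=> x; rewrite !mxE; ring.
have vk : v k = - v i by rewrite !vE cE ql; apply/rowP => x; rewrite !mxE; field.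
have vl : v l = - v j by rewrite !vE cE ql; apply/rowP => x; rewrite !mxE; field.
have vq x y : q x - q y = v x - v y by rewrite !vE opprB addrA subrK.
pose r2 := dot (v i) (v i).
have vjj : dot (v j) (v j) = r2.
  by move: orth; rewrite !vq vl !dotlin (dotC (v j) (v i)) /r2; lra.
have vij : dot (v i) (v j) = 0.
  have : dot (q j - q i) (q j - q i) = dot (q l - q i) (q l - q i) by rewrite -!enorm_sqr sides.
  by rewrite !vq vl !dotlin (dotC (v j) (v i)); lra.
have vr x : dot (v x) (v x) = r2.
  by have := mem_uniq4 u x; rewrite !inE => /or4P[] /eqP ->; rewrite ?vk ?vl ?dotNl ?dotNr ?opprK.
split; last by exists (Num.sqrt r2) => x; rewrite -vE /enorm vr.
pose a := Num.sqrt (2 * r2); pose e := Num.sqrt (4 * r2).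
(* At a vertex [x] the two sides together and the diagonal each pull along [- 2 *: v x], so the
   excesses of side [a] and diagonal [e] must cancel. *)
pose K := ((a ^+ 3)^-1 + (e ^+ 3)^-1) / 2.
exists K.
have side x y : dot (v x) (v y) = 0 -> dist q x y = a.
  by move=> xy; rewrite /dist /enorm vq !dotlin !vr (dotC (v y)) xy; congr Num.sqrt; ring.
have vertex x y z w : uniq [:: x; y; z; w] -> v z = - v x -> v w = - v y -> dot (v x) (v y) = 0 ->
    \sum_t (m t * excess K q x t) *: (q t - q x) = 0.
  move=> u' vz vw xy; rewrite (big_uniq4 _ u') !(meq _ x) subrr scaler0 add0r.
  have dz : dist q x z = e.
    by rewrite /dist /enorm vq vz !dotlin !vr; congr Num.sqrt; ring.
  rewrite /excess dz !side // ?vw ?dotNr ?xy ?oppr0 // !vq vz vw /K.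
  by move: (a ^+ 3)^-1 (e ^+ 3)^-1 => a3 e3; apply/rowP => t; rewrite !mxE; field.
have vji : dot (v j) (v i) = 0 by rewrite dotC.
have u1 : uniq [:: j; k; l; i] by rewrite -[_ :: _]/(rot 1 [:: i; j; k; l]) rot_uniq.
have u2 : uniq [:: k; l; i; j] by rewrite -[_ :: _]/(rot 2 [:: i; j; k; l]) rot_uniq.
have u3 : uniq [:: l; i; j; k] by rewrite -[_ :: _]/(rot 3 [:: i; j; k; l]) rot_uniq.
have [vik vjl] : v i = - v k /\ v j = - v l by rewrite vk vl !opprK.
move=> x; have := mem_uniq4 u x; rewrite !inE => /or4P[] /eqP ->.
- exact: vertex u _ _ _.
- by apply: vertex u1 _ _ _; rewrite ?vk ?dotNr ?vji ?oppr0 // opprK.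
- by apply: vertex u2 _ _ _; rewrite // vk vl dotNl dotNr vij !oppr0.
by apply: vertex u3 _ _ _; rewrite // vl dotNl vji oppr0.
Qed.

Lemma tetrahedron_balanced (R : realType) (m : 'I_4 -> R) (q : 'I_4 -> 'rV[R]_3) :
  is_regular_tetrahedron q ->
  (exists K, balanced K m q) /\ (exists rho, forall i, enorm (q i - centroid q) = rho).
Proof.
move=> [s [s0 qs]]; split.
  exists (s ^+ 3)^-1 => i; apply: big1 => j _; have [->|ji] := eqVneq j i.
    by rewrite subrr scaler0.
  by rewrite /excess /dist qs // subrr mulr0 scale0r.
have [v vE] : exists v, forall x, v x = q x - centroid q by exists (fun x => q x - centroid q).
have v0 : \sum_x v x = 0.
  under eq_bigr do rewrite vE; rewrite sumrB sumr_const card_ord /centroid.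
  by rewrite -[_ *+ 4]scaler_nat scalerA mulfV ?pnatr_eq0 // scale1r subrr.
(* The squared distances from vertex [i], expanded about the centroid, determine its distance to the
   centroid independently of [i]. *)
have D i : \sum_x dot (v x) (v x) + 4 * dot (v i) (v i) = 3 * s ^+ 2.
  transitivity (\sum_x dot (v x - v i) (v x - v i)).
    transitivity (\sum_x dot (v x) (v x) + \sum_(x < 4) dot (v i) (v i)
        - 2 * dot (\sum_x v x) (v i)).
      by rewrite v0 dot0l mulr0 subr0 sumr_const card_ord mulr_natl.
    rewrite dot_suml mulr_sumr -big_split -sumrB; apply: eq_bigr => x _.
    by rewrite !dotlin (dotC (v i) (v x)) /=; ring.
  rewrite (bigD1 i) //= subrr dot0l add0r.
  rewrite (eq_bigr (fun=> s ^+ 2)) => [|x xi].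
    by rewrite sumr_const cardC1 card_ord mulr_natl.
  by rewrite !vE opprB addrA subrK -enorm_sqr qs.
exists (enorm (v ord0)) => i; rewrite -vE /enorm; congr Num.sqrt.
by have := D i; have := D ord0; lra.
Qed.

Lemma centroid_five_central (R : realType) (m : 'I_5 -> R) (q : 'I_5 -> 'rV[R]_3) (k : 'I_5) :
  (forall i, 0 < m i) -> injective q ->
  (forall i j, remove k m i = remove k m j) -> q k = centroid (remove k q) ->
  (exists K, balanced K (remove k m) (remove k q)) /\
  (exists rho, forall i, enorm (remove k q i - centroid (remove k q)) = rho) ->
  central m q /\ central (remove k m) (remove k q).
Proof.
move=> m_gt0 q_inj meq qk [[K bal] [rho qr]].
have m'_gt0 i : 0 < remove k m i by exact: m_gt0.
have q'_inj : injective (remove k q) by move=> i j /q_inj/lift_inj.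
have qc : q k = center_of_mass (remove k m) (remove k q).
  by rewrite qk centroid_of_equal_masses.
split; last by apply/(centralP (n := 2) m'_gt0 q'_inj); exists K.
apply/(centralP (n := 3) m_gt0 q_inj).
by apply: (centered_balanced m_gt0 bal qc (rho := rho)) => i; rewrite qk.
Qed.

(** By Pythagoras the axial body is at distance [r0] from the other four, so all its interaction
    terms vanish and the multiplier of the four bodies still works. *)
Lemma cocircular_five_central (R : realType) (m : 'I_5 -> R) (q : 'I_5 -> 'rV[R]_3)
  (k : 'I_5) (o nu : 'rV[R]_3) (r t : R) :
  (forall i, 0 < m i) -> injective q ->
  is_circle o nu r -> (forall i, on_circle o nu r (remove k q i)) ->
  central (remove k m) (remove k q) -> q k = o + t *: nu ->
  `|t| = Num.sqrt (r0 (remove k m) (remove k q) ^+ 2 - r ^+ 2) -> central m q.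
Proof.
move=> m_gt0 q_inj circ qo cen qk ht.
have m'_gt0 i : 0 < remove k m i by exact: m_gt0.
have q'_inj : injective (remove k q) by move=> i j /q_inj/lift_inj.
have s0 := r0_gt0 (n := 2) m'_gt0 q'_inj.
have [K bal] := (centralP (n := 2) m'_gt0 q'_inj).1 cen.
have Ks := balanced_r0 (n := 2) m'_gt0 q'_inj bal; rewrite {}Ks in bal.
move: (r0 _ _) s0 bal ht => s s0 bal ht.
have rs := cocircular_radius_le m'_gt0 q'_inj s0 bal circ qo.
case: circ => nu1 r_gt0; have t2 : t ^+ 2 = s ^+ 2 - r ^+ 2.
  rewrite -(ger0_norm (sqr_ge0 t)) normrX ht sqr_sqrtr // subr_ge0.
  by rewrite ler_pXn2r // nnegrE ltW.
apply/(centralP (n := 3) m_gt0 q_inj); exists (s ^+ 3)^-1.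
apply: (equidistant_balanced m_gt0 bal (s := s)) => // i; case: (qo i) => ini inr.
apply/eqP; rewrite enorm_eq; last exact: ltW.
rewrite qk opprD addrA dotBl !(dotDr (remove k q i - o)) !dotNr !dotZl !dotZr.
rewrite (dotC nu (remove k q i - o)) ini.
by rewrite -!enorm_sqr inr nu1 -(subrK (r ^+ 2) (s ^+ 2)) -t2; apply/eqP; ring.
Qed.

(** * Every configuration is of one of the three types *)

Lemma normal_circle (R : realType) (m : 'I_4 -> R) (q : 'I_4 -> 'rV[R]_3) (p : 'rV[R]_3)
  (K s : R) (i j k l : 'I_4) : injective q -> 0 < m l -> balanced K m q ->
  uniq [:: i; j; k; l] -> excess K q i l != 0 -> (forall x, enorm (q x - p) = s) ->
  exists o nu r, [/\ is_circle o nu r, forall x, on_circle o nu r (q x) &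
    exists t, p = o + t *: nu /\ `|t| = Num.sqrt (s ^+ 2 - r ^+ 2)].
Proof.
move=> q_inj ml bal u Sil qs.
have [nu nu1 [jnu knu]] := exists_normal (q j - q i) (q k - q i).
(* The balance at [i], with its nonzero coefficient at [l], puts [q l] in the plane of the other
   three bodies. *)
have lnu : dot (q l - q i) nu = 0.
  have E : dot (\sum_x (m x * excess K q i x) *: (q x - q i)) nu = 0 by rewrite bal dot0l.
  rewrite (big_uniq4 _ u) 3!dotDl !dotZl jnu knu subrr dot0l !mulr0 !add0r in E.
  by move/eqP: E; rewrite !mulf_eq0 (gt_eqF ml) (negPf Sil) => /eqP.
have xnu x : dot (q x - q i) nu = 0.
  have := mem_uniq4 u x; rewrite !inE => /or4P[] /eqP -> //.
  by rewrite subrr dot0l.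
have nn : dot nu nu = 1 by rewrite -enorm_sqr nu1 expr1n.
(* The circle is the section of the sphere by that plane; its center [o] is the foot of the
   perpendicular from [p]. *)
pose h := dot (q i - p) nu; pose o := p + h *: nu.
have xh x : dot (q x - p) nu = h.
  by rewrite -(subrKA (q i) (q x)) dotDl xnu add0r.
have xo x : dot (q x - o) (q x - o) = s ^+ 2 - h ^+ 2.
  rewrite /o opprD addrA dotBl !(dotBr (q x - p)) !dotZl (dotC nu (q x - p)).
  by rewrite -(enorm_sqr (q x - p)) qs !dotZr xh nn; ring.
have r2 : 0 <= s ^+ 2 - h ^+ 2 by rewrite -(xo i) dot_ge0.
exists o, nu, (Num.sqrt (s ^+ 2 - h ^+ 2)); split.
- split=> //; rewrite sqrtr_gt0 lt_neqAle r2 andbT eq_sym.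
  apply: contraTneq u => z; have qo x : q x = o.
    by apply/eqP; rewrite -subr_eq0 -dot_eq0 xo z.
  have -> : i = j by apply: q_inj; rewrite !qo.
  by rewrite /= inE eqxx.
- move=> x; split; last by rewrite /enorm xo.
  by rewrite /o opprD addrA dotBl xh dotZl nn mulr1 subrr.
exists (- h); split; first by rewrite /o scaleNr addrK.
by rewrite sqr_sqrtr // opprB addrCA subrr addr0 sqrtr_sqr normrN.
Qed.

(** With all distances equal to [s], the sum of [sum_mass_sqdist] at [i] is
    [(total_mass m - m i) * s ^+ 2], and it does not depend on [i]. *)
Lemma equidistant_masses (R : realType) (m : 'I_4 -> R) (q : 'I_4 -> 'rV[R]_3) (rho s : R) :
  (forall i, 0 < m i) -> 0 < s -> (forall i j, i != j -> dist q i j = s) ->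
  (forall i, enorm (q i - center_of_mass m q) = rho) -> forall i j, m i = m j.
Proof.
move=> m_gt0 s0 qs qr.
have M0 : total_mass m != 0 := lt0r_neq0 (total_mass_gt0 m_gt0).
have E i : (total_mass m - m i) * s ^+ 2 = 2 * total_mass m * rho ^+ 2.
  have -> : total_mass m - m i = \sum_(j | j != i) m j.
    by rewrite /total_mass (bigD1 i) //= addrAC subrr add0r.
  rewrite -(sum_mass_sqdist qr M0 erefl i) [RHS](bigD1 i) //= dist0 expr0n mulr0 add0r.
  by rewrite mulr_suml; apply: eq_bigr => j ji; rewrite qs // eq_sym.
move=> i j; have /(mulIf (lt0r_neq0 (exprn_gt0 2 s0)))/addrI/oppr_inj := etrans (E i) (esym (E j)).
exact.
Qed.

Theorem theorem6 (R : realType) (m : 'I_5 -> R) (q : 'I_5 -> 'rV[R]_3)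
    (m_gt0 : forall i : 'I_5, 0 < m i) (q_inj : injective q) :
  (central m q /\ exists k : 'I_5, central (remove k m) (remove k q)) <->
  [\/ centered_square m q, cocircular_with_axial_mass m q
    | centered_tetrahedron m q].
Proof.
split=> [[cen [k cen']]|]; last first.
  case=> [[k [meq sq qk]]|[k [o [nu [r [circ qo cen' [t [qk ht]]]]]]]|[k [meq tet qk]]].
  - have [] := centroid_five_central m_gt0 q_inj meq qk (square_balanced meq sq).
    by move=> ? ?; split=> //; exists k.
  - by split; [exact: (cocircular_five_central m_gt0 q_inj circ qo cen' qk ht) | exists k].
  - have [] := centroid_five_central m_gt0 q_inj meq qk (tetrahedron_balanced _ tet).
    by move=> ? ?; split=> //; exists k.
have m'_gt0 i : 0 < remove k m i by exact: m_gt0.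
have q'_inj : injective (remove k q) by move=> i j /q_inj/lift_inj.
have [K' bal'] := (centralP (n := 3) m_gt0 q_inj).1 cen.
have [K bal] := (centralP (n := 2) m'_gt0 q'_inj).1 cen'.
have s0 := r0_gt0 (n := 2) m'_gt0 q'_inj.
have Ks := balanced_r0 (n := 2) m'_gt0 q'_inj bal; rewrite {}Ks in bal.
(* This equation keeps the link with [r0], needed for the height, when the value is abstracted to
   [s]. *)
have sE : r0 (remove k m) (remove k q) = r0 (remove k m) (remove k q) by [].
move: {1 3 4}(r0 _ _) sE s0 bal => s sE s0 bal.
have [[_ qs]|[qc [rho qr]]] := five_balanced_cases m_gt0 bal q_inj bal'.
  have {}qs i : enorm (remove k q i - q k) = s.
    by have /invr_inj/eqP := qs i; rewrite eqrXn2 ?enorm_ge0 // ?ltW // => /eqP.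
  (* Four equidistant bodies on a sphere of radius [s] around [q k] would make five equidistant
     points, so only the quadrilateral remains. *)
  have [|[i [j [l [n [u [_ _ _ ni] _ _ _]]]]]] := spherical_balanced m'_gt0 q'_inj qs s0 bal.
    by move/(five_equidistant s0 qs).
  have in_ : n != i.
    by apply: contraTneq u => ->; rewrite /= !inE eqxx !orbT.
  have Sin : excess (s ^+ 3)^-1 (remove k q) i n != 0.
    by rewrite gt_eqF // subr_gt0 invX3_lt // distC // dist_gt0.
  have [o [nu [r [circ qo t]]]] := normal_circle q'_inj (m'_gt0 n) bal u Sin qs.
  by apply: Or32; exists k, o, nu, r; split=> //; rewrite -sE.
rewrite qc in qr.
have [qs|[i [j [l [n [u sides _ _ ES]]]]]] := spherical_balanced m'_gt0 q'_inj qr s0 bal.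
  have meq := equidistant_masses m'_gt0 s0 qs qr.
  apply: Or33; exists k; split=> //; last by rewrite qc centroid_of_equal_masses.
  by exists s; split=> // i j ij; rewrite enormB; apply: qs.
have [meq sq cq] := centered_square_of_sides m'_gt0 q'_inj s0 bal qr u sides ES.
by apply: Or31; exists k; split=> //; rewrite qc cq.
Qed.
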